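(* Let $A\in\mathbb{R}^{n\times n}$ be a non-singular Hermitian (i.e. real symmetric, possibly indefinite) matrix. Given $n_c$ and a non-singular Hermitian relaxation operator $M\in\mathbb{R}^{n\times n}$ such that $M^{-1}A$ is diagonalizable, consider the generalized eigenvalue problem $$A\mathbf v_i=\lambda_iM\mathbf v_i,\qquad i=1,\dots,n,$$ with the eigenvalues ordered such that $|1-\lambda_1|\ge|1-\lambda_2|\ge\cdots\ge|1-\lambda_n|$. Let the optimal interpolation operator $P_\sharp\in\mathbb{C}^{n\times n_c}$ satisfy $$\operatorname{range}(P_\sharp)=\operatorname{span}\{\mathbf v_1,\dots,\mathbf v_{n_c}\},$$ where it is assumed that, when complex conjugate eigenpairs are considered, if one complex conjugate eigenvector is placed in $\operatorname{range}(P_\sharp)$, then the other must be as well. Then, letting $R_\sharp=P_\sharp^*$, the spectral radius of the two-grid error transfer operator $$E_{TG}(P_\sharp)=(I-P_\sharp(P_\sharp^*AP_\sharp)^{-1}P_\sharp^*A)(I-M^{-1}A)$$ is given by $$\rho\left(E_{TG}(P_\sharp)\right)=|1-\lambda_{n_c+1}|.$$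
   Context: $(\cdot)^*$ denotes the conjugate transpose and $\rho(\cdot)$ the spectral radius. The coarse dimension satisfies $n_c<n$. The generalized eigenvectors $\mathbf v_1,\dots,\mathbf v_n\in\mathbb{C}^n$ form a full set of $n$ linearly independent eigenvectors. Since $A$ and $M$ are real, non-real eigenvalues occur in complex conjugate pairs, and the condition on complex conjugate eigenpairs refers to the eigenvectors corresponding to both eigenvalues of such a pair.
   Formalization: Invertibility of P♯*AP♯ is assumed only if some eigenvalue occurs both among λ_1..λ_{n_c} and the rest, and proved otherwise; without it E_TG can be undefined, e.g. A = M = diag(1,−1), v_1 = (1,1), v_2 = (1,−1), n_c = 1 gives P♯*AP♯ = 0. *)

(* Defs.v *)
From HB Require Import structures.
From mathcomp Require Import all_boot all_order all_algebra.
From mathcomp Require Import sesquilinear spectral complex.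
From mathcomp Require Import boolp classical_sets reals.

Set Implicit Arguments.
Unset Strict Implicit.
Unset Printing Implicit Defensive.

Import Order.TTheory GRing.Theory Num.Theory.

#[local] Open Scope ring_scope.
#[local] Open Scope classical_set_scope.
#[local] Open Scope complex_scope.
#[local] Open Scope sesquilinear_scope.

(* The library modulus [`|z|] of z : R[i] is again an element of R[i], with
   zero imaginary part; this is the same number, in R. *)
Definition modulus (R : realType) (z : R[i]) : R := complex.Re `|z|.

Definition complexify (R : realType) m n (B : 'M[R]_(m, n)) : 'M[R[i]]_(m, n) :=
  map_mx (real_complex R) B.

(* [eigenvalue] is defined by row (left) eigenvectors; the set of eigenvalues
   is the same as for column eigenvectors. *)
Definition spectral_radius (R : realType) n (B : 'M[R[i]]_n) : R :=
  sup [set modulus mu | mu in [set mu : R[i] | eigenvalue B mu]].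

Definition mxrange (F : fieldType) m n (B : 'M[F]_(m, n)) : {vspace 'cV[F]_m} :=
  limg (linfun (mulmx B : 'cV[F]_n -> 'cV[F]_m)).

Definition coarse_operator (R : realType) n nc
    (A : 'M[R]_n) (P : 'M[R[i]]_(n, nc)) : 'M[R[i]]_nc :=
  P^t* *m complexify A *m P.

Definition E_TG (R : realType) n nc
    (A M : 'M[R]_n) (P : 'M[R[i]]_(n, nc)) : 'M[R[i]]_n :=
  (1%:M - P *m invmx (coarse_operator A P) *m P^t* *m complexify A)
    *m (1%:M - invmx (complexify M) *m complexify A).

(* [s] matches every eigenpair of a non-real eigenvalue with an eigenpair of
   the conjugate eigenvalue; through [s], repeated non-real eigenvalues are
   paired off with multiplicity. *)
Definition conjugate_closed (R : realType) n (lam : 'I_n -> R[i])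
    (v : 'I_n -> 'cV[R[i]]_n) (W : {vspace 'cV[R[i]]_n}) : Prop :=
  exists s : 'I_n -> 'I_n,
    [/\ involutive s,
        forall i, lam (s i) = (lam i)^* &
        forall i, lam i \isn't Num.real -> v i \in W -> v (s i) \in W].

(* An eigenvalue is repeated on both sides of the cutoff nc, so the chosen
   eigenvectors split its eigenspace; the indefinite form A may then be
   degenerate on the span of v_0, ..., v_(nc-1). *)
Definition splits_eigenvalue (R : realType) n (lam : 'I_n -> R[i]) (nc : nat) :
    Prop :=
  exists i j : 'I_n, [/\ (i < nc)%N, (nc <= j)%N & lam i = lam j].

(* Main.v *)
(** Modulo [W = range P] the coarse correction is the identity, and [W], being
    invariant under [M^-1 A], is annihilated by [E_TG]; hence the eigenvalues
    of [E_TG] are 0 (if [nc > 0]) and the [1 - lam i] with [i >= nc], and the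
    latter have the rows of the inverse eigenvector matrix as left eigenvectors.

    [P^* A P] is invertible because [v_j^* A v_i = 0] unless
    [lam i = (lam j)^*]: when no eigenvalue is split by the cutoff and [W] is
    closed under conjugate pairs, any [w] in [W] with [P^* A w = 0] is thus
    annihilated by all [v_i^* A], so [A w = 0]. *)
Require Import Defs.
From HB Require Import structures.
From mathcomp Require Import all_boot all_order all_algebra.
From mathcomp Require Import sesquilinear spectral complex.
From mathcomp Require Import boolp classical_sets reals.

Set Implicit Arguments.
Unset Strict Implicit.
Unset Printing Implicit Defensive.

Import Order.TTheory GRing.Theory Num.Theory.

#[local] Open Scope ring_scope.
#[local] Open Scope complex_scope.
#[local] Open Scope sesquilinear_scope.

Lemma mulmx_diag_eigen (F : fieldType) n (S V : 'M[F]_n) (e : 'rV[F]_n) i :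
  S *m V = V *m diag_mx e -> V \in unitmx ->
  row i (invmx V) *m S = e 0 i *: row i (invmx V).
Proof.
move=> hS hV.
have hSV : invmx V *m S = diag_mx e *m invmx V.
  by rewrite -[S](mulmxK hV) hS !mulmxA mulVmx // mul1mx.
by rewrite -row_mul hSV row_mul row_diag_mx -scalemxAl -rowE.
Qed.

Lemma rowsub_invmxK (F : fieldType) n nc (f : 'I_nc -> 'I_n) (V : 'M[F]_n) :
  injective f -> V \in unitmx -> rowsub f (invmx V) *m colsub f V = 1%:M.
Proof.
move=> f_inj hV; rewrite mulmx_colsub mul_rowsub_mx mulVmx //.
by apply/matrixP=> i j; rewrite !mxE (inj_eq f_inj).
Qed.

Section Deflation.
Variables (F : fieldType) (n nc : nat) (f : 'I_nc -> 'I_n).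
Variables (S V : 'M[F]_n) (e : 'rV[F]_n).
Variables (Q : 'M[F]_nc) (Z : 'M[F]_(nc, n)).
Hypotheses (hV : V \in unitmx) (hQ : Q \in unitmx).
Hypothesis hS : S *m V = V *m diag_mx e.
Let P := colsub f V *m Q.
(** This makes [P *m Z] a projector onto the range of [P]; [Z] stands for the coarse solve
    $(P^*AP)^{-1}P^*A$. *)
Hypothesis hZ : Z *m P = 1%:M.

Lemma deflation_eigenvalue i :
  i \notin codom f -> eigenvalue ((1%:M - P *m Z) *m S) (e 0 i).
Proof.
move=> fi; apply/eigenvalueP; exists (row i (invmx V)); last first.
  apply/eqP => /(congr1 (mulmx^~ V)); rewrite -row_mul mulVmx // mul0mx.
  by move/rowP/(_ i); rewrite !mxE eqxx => /eqP; rewrite oner_eq0.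
have hP : row i (invmx V) *m P = 0.
  rewrite mulmxA mulmx_colsub -row_mul mulVmx //.
  have -> : colsub f (row i (1%:M : 'M[F]_n)) = 0; last by rewrite mul0mx.
  apply/rowP=> j; rewrite !mxE; case: eqP => // ij.
  by case/negP: fi; rewrite ij codom_f.
by rewrite mulmxA mulmxBr mulmx1 mulmxA hP mul0mx subr0
   (mulmx_diag_eigen _ hS hV).
Qed.

(** If [mu] is nonzero, a left eigenvector [x] must annihilate [P]. Hence the projector drops out,
    [x] is a left eigenvector of [S] itself, and any nonzero coordinate of [x *m V] identifies
    [mu]. *)
Lemma deflation_eigenvalue_inv mu :
  eigenvalue ((1%:M - P *m Z) *m S) mu ->
  mu = 0 \/ exists2 i, i \notin codom f & mu = e 0 i.
Proof.
move=> /eigenvalueP[x hx x0].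
have [->|mu0] := eqVneq mu 0; [by left | right].
(* The range of [P] is invariant under [S], so the deflated matrix kills [P]. *)
have SP : S *m P = P *m (invmx Q *m diag_mx (colsub f e) *m Q).
  rewrite /P !mulmxA mulmxK // mulmx_colsub hS; congr (_ *m _).
  by rewrite !mul_mx_diag; apply/matrixP=> i j; rewrite !mxE.
have PZP : (1%:M - P *m Z) *m P = 0.
  by rewrite mulmxBl mul1mx -(mulmxA P Z) hZ mulmx1 subrr.
have xP : x *m P = 0.
  apply: (scalerI mu0); rewrite scaler0 scalemxAl -hx -(mulmxA x).
  by rewrite -(mulmxA _ S) SP (mulmxA _ P) PZP mul0mx mulmx0.
have xS : x *m S = mu *: x.
  by rewrite -hx mulmxA mulmxBr mulmx1 mulmxA xP mul0mx subr0.
have xV0 : x *m V != 0.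
  by apply: contraNneq x0 => xV; rewrite -[x](mulmxK hV) xV mul0mx.
have [i xVi] := rV0Pn _ xV0.
exists i.
  apply: contraNN xVi => /codomP[j ->].
  have : x *m colsub f V = 0.
    by rewrite -[colsub f V](mulmxK hQ) mulmxA xP mul0mx.
  by rewrite mulmx_colsub => /rowP/(_ j); rewrite !mxE => ->.
have /rowP/(_ i) : mu *: (x *m V) = x *m V *m diag_mx e.
  by rewrite scalemxAl -xS -!mulmxA hS.
rewrite mul_mx_diag; move: (x *m V) xVi => y yi.
by rewrite !mxE mulrC; apply: mulfI.
Qed.

End Deflation.

(** Moving [A] onto [y] or onto [x] turns $x^*Ay$ into $b\,x^*My$ or $\bar a\,x^*My$; distinct
    factors force $x^*My=0$. *)
Lemma eigenvector_orthogonal (C : numClosedFieldType) n (A M : 'M[C]_n)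
    (a b : C) (x y : 'cV[C]_n) :
  A^t* = A -> M^t* = M ->
  A *m x = a *: (M *m x) -> A *m y = b *: (M *m y) -> a^*%R != b ->
  x^t* *m A *m y = 0.
Proof.
move=> hA hM hx hy ab.
have ADl : x^t* *m A *m y = b *: (x^t* *m M *m y).
  by rewrite -mulmxA hy -scalemxAr mulmxA.
have ADr : x^t* *m A *m y = a^*%R *: (x^t* *m M *m y).
  have -> : x^t* *m A = (A *m x)^t* by rewrite trmx_mul map_mxM hA.
  by rewrite hx linearZ /= map_mxZ trmx_mul map_mxM hM -!scalemxAl.
have /eqP := ADr; rewrite {1}ADl -subr_eq0 -scalerBl scaler_eq0 subr_eq0.
by rewrite eq_sym (negbTE ab) /= => /eqP xMy; rewrite ADl xMy scaler0.
Qed.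

Lemma galerkin_unit (C : numClosedFieldType) n nc (f : 'I_nc -> 'I_n)
    (A V : 'M[C]_n) :
  injective f -> A \in unitmx -> V \in unitmx ->
  (forall i j, i \notin codom f -> (col (f j) V)^t* *m A *m col i V = 0) ->
  (colsub f V)^t* *m A *m colsub f V \in unitmx.
Proof.
move=> f_inj hA hV ortho; rewrite -row_free_unit; apply: inj_row_free => w hw.
set W := colsub f V in hw *.
(* Coordinates in the image of [f] vanish because [w] is in the left kernel, the others by
   [ortho]. *)
have yV : w *m W^t* *m A *m V = 0.
  apply/rowP=> i; rewrite [RHS]mxE.
  have [/codomP[j ->]|fi] := boolP (i \in codom f).
    have := hw; rewrite !mulmxA mulmx_colsub => /rowP/(_ j).
    by rewrite mxE [RHS]mxE.
  have -> : (w *m W^t* *m A *m V) 0 i = (w *m (W^t* *m A *m col i V)) 0 0.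
    by rewrite colE !mulmxA -colE [RHS]mxE.
  suff -> : W^t* *m A *m col i V = 0 by rewrite mulmx0 mxE.
  apply/row_matrixP => j; rewrite row0 !row_mul -(ortho i j fi).
  by congr (_ *m _ *m _); apply/rowP=> r; rewrite !mxE.
have wW : w *m W^t* = 0.
  by rewrite -[w *m _](mulmxK hA) -[_ *m A](mulmxK hV) yV !mul0mx.
have WL : W^t* *m (rowsub f (invmx V))^t* = 1%:M.
  by rewrite -map_mxM -trmx_mul rowsub_invmxK // trmx1 map_mx1.
by rewrite -[w]mulmx1 -WL mulmxA wW mul0mx.
Qed.

Lemma memv_mxrange (F : fieldType) m n (B : 'M[F]_(m, n)) x :
  reflect (exists c, x = B *m c) (x \in mxrange B).
Proof.
apply: (iffP memv_imgP) => [[c _ ->]|[c ->]]; exists c;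
  by rewrite ?memvf ?lfunE.
Qed.

(** Equal ranges give $P=WQ$ and $W=PQ'$; then $W=WQQ'$, and cancelling [W] with [L] leaves
    $QQ'=1$. *)
Lemma mxrange_eq_factor (F : fieldType) m n (P W : 'M[F]_(m, n))
    (L : 'M[F]_(n, m)) :
  L *m W = 1%:M -> mxrange P = mxrange W ->
  exists2 Q, Q \in unitmx & P = W *m Q.
Proof.
move=> LW PW.
have factor (B D : 'M[F]_(m, n)) :
    mxrange B = mxrange D -> exists Q, B = D *m Q.
  move=> BD; have /fin_all_exists[c hc] j : exists c, col j B = D *m c.
    by apply/memv_mxrange; rewrite -BD colE; apply/memv_mxrange;
       exists (delta_mx j 0).
  exists (\matrix_(i, j) c j i 0); apply/matrixP=> i j.
  have /colP/(_ i) := hc j; rewrite !mxE => ->.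
  by apply: eq_bigr => k _; rewrite mxE.
have [Q PQ] := factor _ _ PW; have [Q' WQ] := factor _ _ (esym PW).
exists Q => //; suff /mulmx1_unit[] : Q *m Q' = 1%:M by [].
by rewrite -LW {1}WQ PQ -[Q *m Q']mul1mx -LW !mulmxA.
Qed.

Lemma mxrange_span (F : fieldType) m n (B : 'M[F]_(m, n)) :
  mxrange B = <<[seq col j B | j <- enum 'I_n]>>%VS.
Proof.
apply/eqP; rewrite eqEsubv; apply/andP; split.
  apply/subvP => x /memv_mxrange[c ->].
  have -> : B *m c = \sum_j c j 0 *: col j B.
    apply/colP=> i; rewrite mxE summxE; apply: eq_bigr => j _.
    by rewrite !mxE mulrC.
  apply: memv_suml => j _; apply: memvZ; apply: memv_span.
  by apply: map_f; rewrite mem_enum.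
apply/span_subvP => _ /mapP[j _ ->]; apply/memv_mxrange.
by exists (delta_mx j 0); rewrite colE.
Qed.

Lemma free_unitmx (F : fieldType) n (v : 'I_n -> 'cV[F]_n) :
  free [seq v i | i <- enum 'I_n] -> \matrix_(r, k) v k r 0 \in unitmx.
Proof.
move=> hv; rewrite -unitmx_tr -row_free_unit; apply: inj_row_free => u hu.
have ht : free [tuple v i | i < n] by [].
apply/rowP => i; rewrite mxE; apply: (freeP ht (fun i => u 0 i)).
apply/colP => r; have /rowP/(_ r) := hu; rewrite !mxE summxE; apply: etrans.
apply: eq_bigr => k _; rewrite (nth_map k) ?size_enum_ord // nth_ord_enum.
by rewrite !mxE.
Qed.

Lemma complexify_trmxC (R : realType) n (B : 'M[R]_n) :
  B^T = B -> (complexify B)^t* = complexify B.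
Proof.
move=> hB; apply/matrixP=> i j; rewrite -{2}hB !mxE.
by rewrite [LHS]conjc_real.
Qed.

Lemma modulus_ge0 (R : realType) (z : R[i]) : 0 <= modulus z.
Proof. by rewrite /modulus normc_def sqrtr_ge0. Qed.
(* The inverse in E_TG must exist.  [hcoarse] asks for this only when an
   eigenvalue is repeated across the cutoff nc: A and M being possibly
   indefinite, P^* A P can then be singular (A = M = diag(1, -1), nc = 1,
   v_1 = (1, 1)).  Otherwise it is part of the conclusion. *)
Theorem corollary5p3 (R : realType) (n nc : nat) (hnc : (nc < n)%N)
    (A M : 'M[R]_n)
    (hAsym : A^T = A) (hA : A \in unitmx)
    (hMsym : M^T = M) (hM : M \in unitmx)
    (hdiag : diagonalizable (invmx (complexify M) *m complexify A))
    (lam : 'I_n -> R[i]) (v : 'I_n -> 'cV[R[i]]_n)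
    (hfree : free [seq v i | i <- enum 'I_n])
    (heig : forall i, complexify A *m v i = lam i *: (complexify M *m v i))
    (hord : forall i j : 'I_n, (i <= j)%N ->
              modulus (1 - lam j) <= modulus (1 - lam i))
    (P : 'M[R[i]]_(n, nc))
    (hP : mxrange P = <<[seq v i | i : 'I_n <- enum 'I_n & (i < nc)%N]>>%VS)
    (hconj : conjugate_closed lam v (mxrange P))
    (hcoarse : splits_eigenvalue lam nc -> coarse_operator A P \in unitmx) :
  coarse_operator A P \in unitmx /\
  spectral_radius (E_TG A M P) = modulus (1 - lam (Ordinal hnc)).
Proof.
pose f := widen_ord (ltnW hnc) : 'I_nc -> 'I_n.
have f_inj : injective f by move=> i j /(congr1 val) /= /val_inj.
have codom_fE i : (i \in codom f) = (i < nc)%N.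
  apply/codomP/idP => [[j ->] | hi]; first exact: (ltn_ord j).
  by exists (Ordinal hi); apply: val_inj.
pose V := \matrix_(r, k) v k r 0 : 'M[R[i]]_n.
have hV : V \in unitmx by exact: free_unitmx.
have colV i : col i V = v i by apply/colP=> r; rewrite !mxE.
set cA := complexify A in heig *; set cM := complexify M in heig *.
have ucA : cA \in unitmx by rewrite map_unitmx.
have ucM : cM \in unitmx by rewrite map_unitmx.
have rangeP : mxrange P = mxrange (colsub f V).
  rewrite hP mxrange_span; apply: eq_span => x.
  have colW j : col j (colsub f V) = v (f j).
    by rewrite -colV; apply/colP=> r; rewrite !mxE.
  apply/mapP/mapP => [[k] | [j _ ->]]; last first.
    by exists (f j); rewrite ?colW // mem_filter mem_enum /= ltn_ord.
  rewrite mem_filter -codom_fE => /andP[/codomP[j ->] _] ->.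
  by exists j; rewrite ?colW ?mem_enum.
have [Q uQ PE] := mxrange_eq_factor (rowsub_invmxK f_inj hV) rangeP.
(* Needed to read [conjugate_closed] as a statement on indices. If [v i] is in the range, applying
   [invmx V] and comparing coordinate [i] puts [i] in the image of [f]. *)
have v_mem i : (v i \in mxrange P) = (i < nc)%N.
  rewrite rangeP -codom_fE.
  apply/memv_mxrange/codomP => [[c] | [j ->]]; last first.
    by exists (delta_mx j 0); rewrite -colE -colV; apply/colP=> r; rewrite !mxE.
  rewrite -(mulmx1 V) -mulmx_colsub -mulmxA -colV colE.
  move=> /(congr1 (mulmx (invmx V))); rewrite !mulKmx // => /colP/(_ i).
  rewrite !mxE !eqxx => /eqP; apply: contraTP => nij.
  rewrite big1 ?oner_eq0 // => j _; rewrite !mxE.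
  case: eqP => [ij|]; last by rewrite mul0r.
  by case: nij; exists j.
have coarse_unit : coarse_operator A P \in unitmx.
  have [|nosplit] := pselect (splits_eigenvalue lam nc); first exact: hcoarse.
  rewrite /coarse_operator PE trmx_mul map_mxM.
  have -> : Q^t* *m (colsub f V)^t* *m cA *m (colsub f V *m Q) =
            Q^t* *m ((colsub f V)^t* *m cA *m colsub f V) *m Q.
    by rewrite !mulmxA.
  (* The coarse operator is congruent, through [Q], to the one built on the eigenvectors
     themselves. *)
  rewrite !unitmx_mul uQ map_unitmx unitmx_tr uQ andbT /=.
  apply: galerkin_unit => // i j; rewrite codom_fE -leqNgt => hi.
  rewrite !colV; apply: (eigenvector_orthogonal (complexify_trmxC hAsym)
    (complexify_trmxC hMsym) (heig _) (heig _)).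
  (* If $\overline{\lambda_{f(j)}}=\lambda_i$, the eigenvalue [lam i] also occurs below the cutoff:
     at [f j] when it is real, and otherwise at the conjugate partner [s (f j)]. *)
  apply/eqP => lij; apply: nosplit.
  have [lr|lnr] := boolP (lam (f j) \is Num.real).
    by exists (f j), i; split; rewrite //= -lij conj_Creal.
  have [s [_ lam_s s_mem]] := hconj.
  exists (s (f j)), i; split => //; last by rewrite lam_s.
  by rewrite -v_mem; apply: s_mem => //; rewrite v_mem /= ltn_ord.
split=> //.
pose Z := invmx (coarse_operator A P) *m P^t* *m cA.
have ZP : Z *m (colsub f V *m Q) = 1%:M.
  by rewrite -PE /Z -!mulmxA [P^t* *m _]mulmxA mulVmx.
pose e := \row_i (1 - lam i).
have SV : (1%:M - invmx cM *m cA) *m V = V *m diag_mx e.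
  apply/matrixP=> r i; have colr (B : 'M[R[i]]_n) : B r i = col i B r 0.
    by rewrite mxE.
  rewrite colr colE -mulmxA -colE colV mulmxBl mul1mx -mulmxA heig.
  rewrite -scalemxAr mulKmx //.
  by rewrite mul_mx_diag !mxE mulrBr mulr1 mulrC.
have EE : E_TG A M P =
    (1%:M - (colsub f V *m Q) *m Z) *m (1%:M - invmx cM *m cA).
  by rewrite /E_TG -PE /Z !mulmxA.
(* Indices start at 0, so [k] is the first index left undeflated and carries $\lambda_{n_c+1}$. *)
pose k := Ordinal hnc.
have ek i : e 0 i = 1 - lam i by rewrite mxE.
pose spec := [set mu : R[i] | eigenvalue (E_TG A M P) mu]%classic.
have spec_k : [set modulus mu | mu in spec]%classic (modulus (1 - lam k)).
  exists (1 - lam k) => //; rewrite /spec /= EE -ek; apply: deflation_eigenvalue => //.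
  by rewrite codom_fE ltnn.
have spec_le : ubound [set modulus mu | mu in spec]%classic (modulus (1 - lam k)).
  move=> _ [mu + <-]; rewrite /spec /= EE => /(deflation_eigenvalue_inv hV uQ SV ZP).
  case=> [->|[j]]; first by rewrite {1}/modulus normr0 modulus_ge0.
  by rewrite codom_fE -leqNgt ek => hi ->; apply: hord.
(* The supremum is a maximum: [modulus (1 - lam k)] is both attained and an upper bound, which also
   supplies the nonemptiness and boundedness that [sup] requires. *)
apply/eqP; rewrite eq_le; apply/andP; split.
  by apply: ge_sup => //; exists (modulus (1 - lam k)).
by apply: ub_le_sup => //; exists (modulus (1 - lam k)).
Qed.
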